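(* For a flow $(X,T)$, the following are equivalent: (1) $(X,T)$ is equicontinuous; (2) $(2^X,T)$ is equicontinuous; (3) $(2^X,T)$ is strongly rigid; (4) $(2^X,T)$ is distal.
   Context: A flow $(X,T)$ is an action $(t,x)\mapsto tx$ of an infinite discrete (not necessarily abelian) group $T$ by homeomorphisms on a compact, infinite metric space $(X,d)$; each $t\in T$ is identified with the map $x\mapsto tx$, and $e\in T$ is the identity. The enveloping semigroup $E(X)$ is the closure of $T$ in $X^X$ with the product (point-open) topology; it is a semigroup under composition. A nonempty $I\subset E(X)$ is a left ideal if $E(X)\cdot I\subset I$; a minimal ideal is a closed left ideal containing no left ideal as a proper subset. A minimal idempotent is an idempotent belonging to a minimal ideal. The flow is strongly rigid if every minimal idempotent $u\in E(X)$ is an accumulation point in $E(X)$ endowed with the compact-open topology, i.e. there is a (non-trivial) net $\{t_k\}$ in $T$ with $t_k\to u$ uniformly on $X$; non-trivial means $t_k\neq u$ for all $k$, and in particular, when $u=e$, no $t_k$ is the identity element of $T$. The flow is equicontinuous if for every $y\in X$ and $\epsilon>0$ there is a neighborhood $U$ of $y$ with $d(tx,ty)<\epsilon$ for all $x\in U$, $t\in T$. Points $x,y$ are proximal if the orbit closure of $(x,y)$ in $(X\times X,T)$ meets the diagonal; the flow is distal if no two distinct points are proximal. $2^X$ is the compact metric space of nonempty closed subsets of $X$ with the Hausdorff metric $d_H$; the induced flow $(2^X,T)$ is given by $tA=\{ta:a\in A\}$. All notions above apply to $(2^X,T)$ as a flow. *)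

(* Defs.v *)
From HB Require Import structures.
From mathcomp Require Import all_boot all_order all_algebra.
From mathcomp Require Import all_classical all_reals topology.

Set Implicit Arguments.
Unset Strict Implicit.
Unset Printing Implicit Defensive.

Import Order.TTheory GRing.Theory Num.Theory.
Import numFieldTopology.Exports.

Local Open Scope classical_set_scope.
Local Open Scope ring_scope.

(* Compactness and infinitude of the phase space, and infinitude of [T], are
   not part of the record; each [phi t] is a homeomorphism, with inverse
   [phi t^-1]. *)
Record flow (R : realType) (T : groupType) (X : metricType R) := Flow {
  act :> T -> X -> X ;
  act1 : forall x, act 1%g x = x ;
  actM : forall s t x, act (s * t)%g x = act s (act t x) ;
  act_continuous : forall t, continuous (act t)
}.

Section Flows.
Context {R : realType} {T : groupType} {X : metricType R}.
Implicit Types (phi : flow T X) (u : X -> X).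

Definition flow_equicontinuous phi : Prop :=
  forall (y : X) (eps : R), 0 < eps ->
    \forall x \near y, forall t, mdist (phi t x) (phi t y) < eps.

Definition proximal phi (x y : X) : Prop :=
  closure (range (fun t => (phi t x, phi t y))) `&` diagonal !=set0.

Definition distal phi : Prop := forall x y, proximal phi x y -> x = y.

Definition enveloping phi : set {ptws X -> X} :=
  closure (range (phi : T -> {ptws X -> X})).

Definition left_ideal phi (I : set {ptws X -> X}) : Prop :=
  [/\ I !=set0, I `<=` enveloping phi &
      forall p q, enveloping phi p -> I q -> I (p \o q)].

Definition minimal_ideal phi (I : set {ptws X -> X}) : Prop :=
  [/\ left_ideal phi I, closed I &
      forall J, left_ideal phi J -> J `<=` I -> J = I].

Definition minimal_idempotent phi u : Prop :=
  u \o u = u /\ exists2 I, minimal_ideal phi I & I u.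

Definition directed_preorder (K : Type) (le : K -> K -> Prop) : Prop :=
  [/\ [set: K] !=set0,
      forall k, le k k,
      forall k l m, le k l -> le l m -> le k m &
      forall k l, exists2 m, le k m & le l m].

Definition tails (K : Type) (le : K -> K -> Prop) : set_system K :=
  filter_from [set: K] (fun k => [set l | le k l]).

(* "t <> u" for an element t of a group acting possibly non-effectively: when
   [u] is the identity map it is compared with the unit of [T] as a group
   element, otherwise with the map [phi t].  For effective actions both
   clauses amount to [phi t <> u], see [nontrivial_at_effective]. *)
Definition nontrivial_at phi u (t : T) : Prop :=
  (u = id -> t <> 1%g) /\ (u <> id -> phi t <> u).

Lemma nontrivial_at_effective phi u t :
  injective phi -> nontrivial_at phi u t <-> phi t <> u.
Proof.
move=> phi_inj; have phi1 : phi 1%g = id by apply/funext => x; rewrite act1.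
split=> [[ut1 utu] tu|tu].
  have [uid|uid] := pselect (u = id); last exact: utu.
  by apply: (ut1 uid); apply: phi_inj; rewrite phi1 tu.
by split=> // uid t1; apply: tu; rewrite t1 phi1.
Qed.

Definition strongly_rigid phi : Prop :=
  forall u, minimal_idempotent phi u ->
    exists (K : Type) (le : K -> K -> Prop) (t_ : K -> T),
      [/\ directed_preorder le,
          forall k, nontrivial_at phi u (t_ k) &
          {uniform, (phi \o t_) @ tails le --> u}].

End Flows.

(* The compactness proof [cX] is a parameter because it is what makes the
   Hausdorff distance finite, hence [hyperspace cX] a metric space. *)
Record hyperspace (R : realType) (X : metricType R) (cX : compact [set: X]) :=
  Hyperspace {
    hset :> set X ;
    hset_closed : closed hset ;
    hset_nonempty : hset !=set0
  }.

Section HausdorffMetric.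
Context {R : realType} {X : metricType R}.
Implicit Types (A B C : set X) (x y : X).

Definition dist_to_set x A : R := inf [set mdist x a | a in A].

Definition hausdorff_excess A B : R := sup [set dist_to_set a B | a in A].

Definition hausdorff_dist A B : R :=
  Num.max (hausdorff_excess A B) (hausdorff_excess B A).

Lemma dist_to_set_le x A a : A a -> dist_to_set x A <= mdist x a.
Proof.
move=> Aa; apply: ge_inf; last by exists a.
by exists 0 => _ [b _ <-]; exact: mdist_ge0.
Qed.

Lemma dist_to_set_ge0 x A : 0 <= dist_to_set x A.
Proof.
have [->|/set0P [a Aa]] := eqVneq A set0.
  by rewrite /dist_to_set image_set0 inf0.
apply: lb_le_inf; first by exists (mdist x a), a.
by move=> _ [b _ <-]; exact: mdist_ge0.
Qed.

Lemma dist_to_set_lt x A e : A !=set0 -> dist_to_set x A < e ->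
  exists2 a, A a & mdist x a < e.
Proof.
move=> [a Aa] xe; have [||_ [b Ab <-] be] := @inf_lt _ [set mdist x a | a in A] e.
- by exists (mdist x a), a.
- exact: xe.
- by exists b.
Qed.

Lemma compact_mdist_bounded (cX : compact [set: X]) x :
  exists M, forall y, mdist x y <= M.
Proof.
have /compact_near_coveringP cov := cX.
have [z _|n _ /(_ n (leqnn n)) xn] :=
    cov nat \oo (fun n y => mdist x y <= n%:R) _; last first.
  by exists n%:R => y; exact: xn.
exists (ball z 1, [set n | mdist x z + 1 <= n%:R]) => /=.
  split; first exact: nbhsx_ballx.
  exists (Num.truncn (mdist x z + 1)).+1 => // n /= zn.
  by rewrite (le_trans (ltW (truncnS_gt _)))// ler_nat.
move=> [y n] /= [zy]; apply: le_trans.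
rewrite (le_trans (metric_triangle x z y))// lerD2l ltW//.
by move: zy; rewrite ballEmdist.
Qed.

Lemma compact_unif_continuous (cX : compact [set: X]) (f : X -> X) e :
  continuous f -> 0 < e ->
  exists2 d, 0 < d & forall x y, mdist x y < d -> mdist (f x) (f y) < e.
Proof.
move=> cf e0; have /compact_near_coveringP cov := cX.
have [z _|d /= d0 /(_ (d / 2))] := cov R 0^'+
    (fun d x => forall y, mdist x y < d -> mdist (f x) (f y) < e)
    (@filter_filter _ _ (at_right_proper_filter 0)).
  have : nbhs (f z) (ball (f z) (e / 2)).
    by apply: nbhsx_ballx; rewrite divr_gt0.
  move=> /cf /nbhs_ballP[r /= r0 zr].
  exists (ball z (r / 2), [set d | d < r / 2]) => /=.
    split; first by apply: nbhsx_ballx; rewrite divr_gt0.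
    exists (r / 2) => /=; first by rewrite divr_gt0.
    by move=> d /=; rewrite sub0r normrN => /ltr_normlW.
  move=> [x d] /= [zx dr] y xy.
  have fz w : ball z r w -> mdist (f z) (f w) < e / 2.
    by move=> /zr; rewrite /= ballEmdist.
  rewrite (le_lt_trans (metric_triangle (f x) (f z) (f y)))//.
  rewrite [e]splitr ltrD//.
    rewrite metric_sym fz//; apply: le_ball zx.
    by rewrite ler_pdivrMr// ler_pMr// ler1n.
  apply: fz; rewrite [r]splitr; apply: ball_triangle zx _.
  by rewrite ballEmdist; exact: lt_trans dr.
move=> H; exists (d / 2); first by rewrite divr_gt0.
move=> x; apply: H => //=; last by rewrite divr_gt0.
rewrite sub0r normrN gtr0_norm ?divr_gt0//.
by rewrite ltr_pdivrMr// ltr_pMr// ltr1n.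
Qed.

Lemma dist_to_set_triangle x y A : A !=set0 ->
  dist_to_set x A <= mdist x y + dist_to_set y A.
Proof.
move=> A0; rewrite -lerBlDl; apply: lb_le_inf.
  by case: A0 => a Aa; exists (mdist y a), a.
move=> _ [a Aa <-]; rewrite lerBlDl.
exact: le_trans (dist_to_set_le x Aa) (metric_triangle _ _ _).
Qed.

Lemma hausdorff_excess_le A B r : A !=set0 ->
  (forall a, A a -> dist_to_set a B <= r) -> hausdorff_excess A B <= r.
Proof.
move=> [a Aa] AB; apply: ge_sup; first by exists (dist_to_set a B), a.
by move=> _ [b Ab <-]; exact: AB.
Qed.

Lemma dist_to_set_excess (cX : compact [set: X]) A B a :
  B !=set0 -> A a -> dist_to_set a B <= hausdorff_excess A B.
Proof.
move=> [b Bb] Aa; apply: ub_le_sup; last by exists a.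
have [M bM] := compact_mdist_bounded cX b.
exists M => _ [c Ac <-]; apply: le_trans (dist_to_set_le c Bb) _.
by rewrite metric_sym.
Qed.

Lemma hausdorff_excess_triangle (cX : compact [set: X]) A B C :
  A !=set0 -> B !=set0 -> C !=set0 ->
  hausdorff_excess A C <= hausdorff_excess A B + hausdorff_excess B C.
Proof.
move=> A0 B0 C0; apply: hausdorff_excess_le => // a Aa.
apply/ler_addgt0Pr => e e0.
have [|b Bb ab] := @dist_to_set_lt a B (hausdorff_excess A B + e) B0.
  by rewrite (le_lt_trans (dist_to_set_excess cX B0 Aa))// ltrDl.
rewrite (le_trans (dist_to_set_triangle a b C0))// addrAC lerD ?(ltW ab)//.
exact: dist_to_set_excess.
Qed.

Lemma hausdorff_excess_subset (cX : compact [set: X]) A B :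
  closed B -> B !=set0 -> hausdorff_excess A B <= 0 -> A `<=` B.
Proof.
move=> cB B0 AB a Aa; apply: cB => V /nbhs_ballP[e /= e0 eV].
have [|b Bb ab] := @dist_to_set_lt a B e B0.
  by rewrite (le_lt_trans (dist_to_set_excess cX B0 Aa))// (le_lt_trans AB).
by exists b; split=> //; apply: eV; rewrite ballEmdist.
Qed.

Lemma hausdorff_excess_ge0 (cX : compact [set: X]) A B :
  A !=set0 -> B !=set0 -> 0 <= hausdorff_excess A B.
Proof.
move=> [a Aa] B0; apply: le_trans (dist_to_set_excess cX B0 Aa).
exact: dist_to_set_ge0.
Qed.

End HausdorffMetric.

Section Hyperspace.
Context {R : realType} {X : metricType R} {cX : compact [set: X]}.
Implicit Types A B C : hyperspace cX.

Lemma hyperspace_eq A B : A = B :> set X -> A = B.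
Proof.
case: A B => [A cA A0] [B cB B0] /= AB; move: cB B0; rewrite -AB => cB B0.
by congr Hyperspace; exact: Prop_irrelevance.
Qed.

Let dH A B := hausdorff_dist A B.

Let dHxx A : dH A A = 0.
Proof.
rewrite /dH /hausdorff_dist maxxx; have A0 := hset_nonempty A.
apply/eqP; rewrite eq_le hausdorff_excess_ge0// andbT.
by apply: hausdorff_excess_le => // a Aa; rewrite -(mdistxx a) dist_to_set_le.
Qed.

Let dH_positivity A B : dH A B = 0 -> A = B.
Proof.
move=> AB; apply: hyperspace_eq.
have /andP[AB0 BA0] : (hausdorff_excess A B <= 0) && (hausdorff_excess B A <= 0).
  by rewrite -ge_max -/(hausdorff_dist A B) -/(dH A B) AB.
by rewrite eqEsubset; split; apply: hausdorff_excess_subset => //;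
  (exact: hset_closed || exact: hset_nonempty).
Qed.

Let dH_sym A B : dH A B = dH B A.
Proof. by rewrite /dH /hausdorff_dist maxC. Qed.

Let dH_triangle B A C : dH A C <= dH A B + dH B C.
Proof.
have := (hset_nonempty A, hset_nonempty B, hset_nonempty C).
move=> [[A0 B0] C0]; rewrite /dH {1}/hausdorff_dist ge_max; apply/andP; split.
  rewrite (le_trans (hausdorff_excess_triangle cX A0 B0 C0))//.
  by rewrite lerD// le_max lexx.
rewrite (le_trans (hausdorff_excess_triangle cX C0 B0 A0))// addrC.
by rewrite lerD// le_max lexx orbT.
Qed.

HB.instance Definition _ := gen_eqMixin (hyperspace cX).
HB.instance Definition _ := gen_choiceMixin (hyperspace cX).
HB.instance Definition _ := isMetric.Build R (hyperspace cX)
  dHxx dH_positivity dH_sym dH_triangle.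

Lemma hyperspace_mdistE A B : mdist A B = hausdorff_dist A B.
Proof. by []. Qed.

End Hyperspace.

Section InducedFlow.
Context {R : realType} {T : groupType} {X : metricType R}.
Variables (cX : compact [set: X]) (phi : flow T X).
Implicit Types A B : hyperspace cX.

Lemma flow_image_preimage t (A : set X) : phi t @` A = phi t^-1%g @^-1` A.
Proof.
rewrite eqEsubset; split=> [_ [a Aa <-]|x Ax] /=.
  by rewrite -actM mulVg act1.
by exists (phi t^-1%g x) => //; rewrite -actM mulgV act1.
Qed.

Lemma flow_image_closed t A : closed (phi t @` A).
Proof.
rewrite flow_image_preimage; apply: preimage_closed; last exact: hset_closed.
by move=> x _; exact: act_continuous.
Qed.

Lemma flow_image_nonempty t A : phi t @` A !=set0.
Proof. by case: (hset_nonempty A) => a Aa; exists (phi t a), a. Qed.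

Definition hyper_act (t : T) A : hyperspace cX :=
  Hyperspace cX (@flow_image_closed t A) (@flow_image_nonempty t A).

Lemma hyper_act1 A : hyper_act 1%g A = A.
Proof.
apply: hyperspace_eq => /=; rewrite flow_image_preimage invg1.
by rewrite eqEsubset; split=> x; rewrite /= act1.
Qed.

Lemma hyper_actM s t A : hyper_act (s * t)%g A = hyper_act s (hyper_act t A).
Proof.
apply: hyperspace_eq => /=; rewrite image_comp; apply: eq_imagel => x _.
exact: actM.
Qed.

Lemma hyper_act_continuous t : continuous (hyper_act t).
Proof.
move=> A V /nbhs_ballP[e /= e0 eV].
have e20 : 0 < e / 2 by rewrite divr_gt0.
have [d d0 H] := compact_unif_continuous cX (@act_continuous _ _ _ phi t) e20.
apply/nbhs_ballP; exists d => //= B; rewrite ballEmdist /= => AB.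
apply: eV; rewrite ballEmdist /= hyperspace_mdistE /hausdorff_dist /=.
have exc (C D : hyperspace cX) : hausdorff_excess C D < d ->
    hausdorff_excess (phi t @` C) (phi t @` D) <= e / 2.
  move=> CD; apply: hausdorff_excess_le; first exact: flow_image_nonempty.
  move=> _ [c Cc <-]; have D0 := hset_nonempty D.
  have [|b Db cb] := @dist_to_set_lt _ _ c D d D0.
    exact: le_lt_trans (dist_to_set_excess cX D0 Cc) CD.
  apply: le_trans (ltW (H _ _ cb)).
  by apply: dist_to_set_le; exists b.
move: AB; rewrite hyperspace_mdistE /hausdorff_dist gt_max => /andP[AB BA].
apply: (@le_lt_trans _ _ (e / 2)); first by rewrite ge_max !exc.
by rewrite ltr_pdivrMr// ltr_pMr// ltr1n.
Qed.

Definition hyperflow : flow T (hyperspace cX) :=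
  Flow hyper_act1 hyper_actM hyper_act_continuous.

End InducedFlow.

(* Main.v *)
Require Import Defs.
From mathcomp Require Import all_boot all_order all_algebra.
From mathcomp Require Import all_classical all_reals topology.
From mathcomp Require Import lra.

Set Implicit Arguments.
Unset Strict Implicit.
Unset Printing Implicit Defensive.

Import Order.TTheory GRing.Theory Num.Theory.
Import metricType_numDomainType.

Local Open Scope classical_set_scope.
Local Open Scope ring_scope.

(** Over a compact space equicontinuity is uniform, and a uniform modulus for
    [phi] passes to images of closed sets; conversely points embed
    isometrically as singletons.  So [phi] and its hyperspace flow are
    equicontinuous together.

    An equicontinuous hyperspace flow is strongly rigid.  If [u] is an
    idempotent of the enveloping semigroup, then [x] and [u x] have the same
    image under [u], so some [t] moves them close together, and [t^-1] brings
    them back close to each other: hence [u = id].  It remains to find [t <> 1]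
    uniformly close to the identity.  By compactness of the enveloping semigroup
    the elements of the infinite group [T] accumulate pointwise somewhere,
    equicontinuity makes this accumulation uniform, and two distinct [s], [t]
    that are uniformly close give [t * s^-1] ([unif_equicontinuous_recurrent]).

    Strongly rigid compact flows are distal, whatever the space.  If [x], [y]
    are proximal, some [p] in the enveloping semigroup identifies them, and so
    does every element of the closed left ideal that [p] generates.  This ideal
    contains a minimal idempotent [u] (Zorn and Ellis, [proximal_idempotent]).
    Strong rigidity makes [u] a uniform limit of surjections, so [u] is
    continuous with dense image; being idempotent, [u = id] and [x = y].  This
    applies to the hyperspace, whose compactness is [hyperspace_compact].

    Finally a distal hyperspace flow forces [phi] to be equicontinuous.  Suppose
    [x -> y] while [phi t x] stays at distance at least [e] from [phi t y].  Let
    [(p, z)] be a cluster point of the pairs formed by the action of [t] on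
    closed sets and the point [phi t x].  With [A_d] the closed ball of radius
    [d] around [y], the point [z] lies in [p A_d] for every [d], but not in
    [p {y}].  In a distal flow the elements of the enveloping semigroup are
    injective and have left inverses, so take [q] with [q p = id].  Since [q] is
    monotone for inclusion, [q {z}] is contained in every [A_d], whence
    [q {z} = {y} = q (p {y})], and injectivity of [q] yields [{z} = p {y}], a
    contradiction ([hyper_distal_equicontinuous]). *)

(** * Metric characterizations *)

Section UniformMetric.
Context {R : realType} {X : metricType R}.

Lemma nbhs_uniform_mdistP (f : X -> X) (P : set {uniform X -> X}) :
  nbhs (f : {uniform X -> X}) P <->
  exists2 e, 0 < e & [set g : X -> X | forall x, mdist (f x) (g x) < e] `<=` P.
Proof.
rewrite uniform_nbhs; split=> [[E [entE EP]]|[e e0 eP]].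
  move: entE; rewrite -entourage_ballE => -[e /= e0 eE].
  exists e => // g fg; apply: EP => x _; apply: eE => /=.
  by rewrite ballEmdist; exact: fg.
exists [set xy | ball xy.1 e xy.2]; split.
  by rewrite -entourage_ballE; exists e.
by move=> g /= fg; apply: eP => x; have := fg x I; rewrite ballEmdist.
Qed.

Lemma mdist_lt_eq (x y : X) : (forall e, 0 < e -> mdist x y < e) -> x = y.
Proof.
move=> xy; apply: mdist_positivity; apply/eqP; rewrite eq_le mdist_ge0 andbT.
by apply/ler_addgt0Pr => e e0; rewrite add0r ltW// xy.
Qed.

End UniformMetric.

(** * The hyperspace of a compact metric space *)

Section Hyperspace.
Context {R : realType} {X : metricType R} {cX : compact [set: X]}.
Implicit Types (A B : hyperspace cX) (x y : X) (e : R).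

Lemma mdist_hyperspace_le A B e :
  (forall a, hset A a -> exists2 b, hset B b & mdist a b <= e) ->
  (forall b, hset B b -> exists2 a, hset A a & mdist b a <= e) ->
  mdist A B <= e.
Proof.
have excess C D : (forall c, C c -> exists2 d, D d & mdist c d <= e) ->
    C !=set0 -> @hausdorff_excess R X C D <= e.
  move=> CD C0; apply: hausdorff_excess_le => // c /CD[d Dd].
  by apply: le_trans; exact: dist_to_set_le.
move=> AB BA; rewrite hyperspace_mdistE /hausdorff_dist ge_max.
by rewrite !excess//; exact: hset_nonempty.
Qed.

Lemma mdist_hyperspace_lt A B e a :
  mdist A B < e -> hset A a -> exists2 b, hset B b & mdist a b < e.
Proof.
rewrite hyperspace_mdistE /hausdorff_dist gt_max => /andP[AB _] Aa.
apply: dist_to_set_lt; first exact: hset_nonempty.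
by apply: le_lt_trans AB; apply: dist_to_set_excess => //; exact: hset_nonempty.
Qed.

Lemma mem_hyperspace A x :
  (forall e, 0 < e -> exists2 a, hset A a & mdist x a < e) -> hset A x.
Proof.
move=> xA; apply: (hset_closed (h := A)) => V /nbhs_ballP[e /= e0 eV].
have [a Aa xa] := xA e e0; exists a; split => //.
by apply: eV; rewrite ballEmdist.
Qed.

Lemma set1_closed x : closed [set x].
Proof.
apply: accessible_closed_set1; apply: hausdorff_accessible.
exact: metric_hausdorff.
Qed.

Definition hyper1 x : hyperspace cX :=
  Hyperspace cX (@set1_closed x) (ex_intro _ x erefl).

Lemma cball_closed x e : closed [set y | mdist x y <= e].
Proof.
move=> y yx /=; apply/ler_addgt0Pr => d d0.
have [|z [/= xz]] := yx (ball y d); first exact: nbhsx_ballx.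
rewrite ballEmdist /= metric_sym => zy.
by rewrite (le_trans (metric_triangle x z y))// lerD// ltW.
Qed.

Lemma cball_nonempty x e : 0 <= e -> [set y | mdist x y <= e] !=set0.
Proof. by move=> e0; exists x; rewrite /= mdistxx. Qed.

Definition cball x e (e0 : 0 <= e) : hyperspace cX :=
  Hyperspace cX (@cball_closed x e) (cball_nonempty x e0).

(** An ultrafilter [F] of closed sets converges to the set [L] of the points
    that are approached by [F]-almost all of its members.  Both halves of the
    Hausdorff distance to [L] become small by a covering argument: over [X] for
    the excess of [A] over [L] (a point off [L] has a neighbourhood that almost
    all [A] avoid, because [F] decides every set), over [L] for the other. *)
Lemma hyperspace_compact : compact [set: hyperspace cX].
Proof.
rewrite compact_ultra => F FU _.
have FF : ProperFilter F by exact: ultra_proper.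
pose meets x e := [set A : hyperspace cX | exists2 a, hset A a & mdist x a < e].
pose L := [set x | forall e, 0 < e -> F (meets x e)].
have notL x : ~ L x -> exists2 e, 0 < e & F (~` meets x e).
  move=> /existsNP[e /not_implyP[e0 Fe]]; exists e => //.
  by have [|] := in_ultra_setVsetC (meets x e) FU.
have near_L e : 0 < e ->
    F [set A | forall x, hset A x -> exists2 y, L y & mdist x y < e].
  move=> e0; have /compact_near_coveringP cov := cX.
  have {}cov := cov _ F
    (fun A x => hset A x -> exists2 y, L y & mdist x y < e) FF.
  apply: (filterS _ (cov _)) => [A HA x|]; first exact: HA.
  move=> x _; have [Lx|/notL[d d0 Fd]] := pselect (L x).
    exists (ball x e, setT) => /=.
      by split; [exact: nbhsx_ballx|exact: filterT].
    by move=> [y A] /= [+ _] _; rewrite ballEmdist /= metric_sym; exists x.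
  exists (ball x d, ~` meets x d) => /=.
    by split => //; exact: nbhsx_ballx.
  move=> [y A] /= [+ nA] Ay; rewrite ballEmdist => xy.
  by exfalso; apply: nA; exists y.
have L_closed : closed L.
  move=> x Lx e e0; have e20 : 0 < e / 2 by rewrite divr_gt0.
  have [|y [Ly]] := Lx (ball x (e / 2)); first exact: nbhsx_ballx.
  rewrite ballEmdist /= => xy; apply: filterS (Ly _ e20) => A [a Aa ya].
  exists a => //; apply: le_lt_trans (metric_triangle x y a) _.
  by rewrite [e]splitr ltrD.
have L_nonempty : L !=set0.
  have [A HA] := filter_ex (near_L 1 ltr01).
  by have [a /HA[y Ly _]] := hset_nonempty A; exists y.
have near_A e : 0 < e ->
    F [set A | forall x, L x -> exists2 a, hset A a & mdist x a < e].
  move=> e0; have e20 : 0 < e / 2 by rewrite divr_gt0.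
  have /compact_near_coveringP cov : compact L by exact: subclosed_compact cX _.
  apply: (cov _ F (fun A x => exists2 a, hset A a & mdist x a < e)) => x Lx.
  exists (ball x (e / 2), meets x (e / 2)) => /=.
    by split; [exact: nbhsx_ballx|exact: Lx].
  move=> [y A] /= [+ [a Aa xa]]; rewrite ballEmdist /= metric_sym => xy.
  exists a => //; apply: le_lt_trans (metric_triangle y x a) _.
  by rewrite [e]splitr ltrD.
exists (Hyperspace cX L_closed L_nonempty); split => //=.
apply/cvgrPdist_le => e e0.
apply: filterS (filterI (near_L e e0) (near_A e e0)).
move=> A [AL LA]; apply: mdist_hyperspace_le => [x /LA[a Aa xa]|a /AL[x Lx ax]].
  by exists a => //; exact: ltW.
by exists x => //; exact: ltW.
Qed.

End Hyperspace.

Arguments hyper1 {R X} cX x.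
Arguments cball {R X} cX x {e} e0.

(** * Minimal closed sets and idempotents *)

Section MinimalClosed.
Context {T : topologicalType}.
Implicit Types (K A B : set T) (C Q : set (set T)).

Lemma compact_chain_bigcap K C : compact K -> C !=set0 ->
  (forall A, C A -> [/\ closed A, A !=set0 & A `<=` K]) ->
  total_on C subset -> \bigcap_(A in C) A !=set0.
Proof.
move=> cK [A0 CA0] Ccl Ctot.
pose F := filter_from C id.
have FF : ProperFilter F.
  apply: filter_from_proper; last by move=> A /Ccl[].
  apply: filter_from_filter; first by exists A0.
  move=> A B CA CB; have [AB|BA] := Ctot _ _ CA CB.
    by exists A => // x Ax; split => //; exact: AB.
  by exists B => // x Bx; split => //; exact: BA.
have [|x [Kx Fx]] := cK F FF; first by exists A0 => //; have [] := Ccl _ CA0.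
exists x => A CA; have [clA _ _] := Ccl _ CA.
by apply: clA => V xV; apply: Fx => //; exists A.
Qed.

(** Zorn's lemma for nonempty closed subsets of a compact set.  The property
    [Q] stands for closure under some operations, which survives arbitrary
    intersections; nonemptiness survives along chains by compactness. *)
Lemma minimal_closed K Q : compact K -> closed K -> K !=set0 -> Q K ->
  (forall C, C !=set0 -> C `<=` Q -> Q (\bigcap_(A in C) A)) ->
  exists M, [/\ closed M, M !=set0, M `<=` K, Q M &
    forall A, closed A -> A !=set0 -> Q A -> A `<=` M -> A = M].
Proof.
move=> cK clK K0 QK Qcap.
(* Minimal sets are sought as complements in [K] of maximal ones. *)
pose P A := [/\ closed (K `\` A), K `\` A !=set0 & Q (K `\` A)].
have [|U [[clU U0 QU] Umax]] := @Zorn_bigcup T P.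
  move=> F FP Ftot; have [F0|/set0P[A0 FA0]] := eqVneq F set0.
    by rewrite F0 bigcup_set0 /P setD0.
  pose C := [set K `\` A | A in F].
  have -> : P (\bigcup_(A in F) A) =
      [/\ closed (\bigcap_(A in C) A), \bigcap_(A in C) A !=set0 &
        Q (\bigcap_(A in C) A)].
    rewrite /P; suff -> : K `\` \bigcup_(A in F) A = \bigcap_(A in C) A by [].
    rewrite eqEsubset; split=> [x [Kx nx] _ [A FA <-]|x Cx].
      by split=> // Ax; apply: nx; exists A.
    split; first by have [] := Cx (K `\` A0) (imageP _ FA0).
    by move=> [A FA Ax]; have [_] := Cx (K `\` A) (imageP _ FA); apply.
  have C0 : C !=set0 by exists (K `\` A0), A0.
  split.
  - by apply: closed_bigI => _ [A /FP[? _ _] <-].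
  - apply: (compact_chain_bigcap cK C0).
      by move=> _ [A /FP[? ? _] <-]; split => // x [].
    move=> _ _ [A FA <-] [B FB <-]; have [AB|BA] := Ftot _ _ FA FB.
      by right; exact: setDS.
    by left; exact: setDS.
  - by apply: Qcap => // _ [A /FP[_ _ ?] <-].
exists (K `\` U); split=> //.
move=> A clA A0 QA AU; have KA : A `<=` K by move=> x /AU[].
apply: contrapT => AnU.
have UA : U `<` ~` A.
  split=> [x Ux /AU[] //|AcU].
  apply: AnU; rewrite eqEsubset; split=> // x [Kx nUx].
  by apply: contrapT => /AcU.
by apply: (Umax _ UA); rewrite /P setDE setCK setIidr.
Qed.

End MinimalClosed.

Section PointwiseMaps.
Context {X : uniformType}.
Implicit Types (p q : {ptws X -> X}) (S M : set {ptws X -> X}).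

Lemma eval_continuous (x : X) : continuous (fun p : {ptws X -> X} => p x).
Proof. exact: (@proj_continuous X (fun _ => X) x). Qed.

Lemma ptws_continuous (Z : topologicalType) (f : Z -> {ptws X -> X}) :
  (forall x, continuous (fun z => f z x)) -> continuous f.
Proof.
by move=> cf z; apply/pointwise_cvgP => x; exact: cf.
Qed.

Lemma comp_continuousl q :
  continuous (fun p : {ptws X -> X} => (p \o q : {ptws X -> X})).
Proof. by apply: ptws_continuous => x; exact: eval_continuous. Qed.

Lemma comp_continuousr (g : X -> X) :
  continuous g ->
  continuous (fun p : {ptws X -> X} => (g \o p : {ptws X -> X})).
Proof.
move=> cg; apply: ptws_continuous => x p.
exact: (continuous_comp (@eval_continuous x p) (cg (p x))).
Qed.

Hypothesis hX : hausdorff_space X.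

Lemma ptws_hausdorff : hausdorff_space {ptws X -> X}.
Proof. exact: hausdorff_product. Qed.

Lemma ptws_set1_closed p : closed [set p].
Proof.
apply: accessible_closed_set1; apply: hausdorff_accessible.
exact: ptws_hausdorff.
Qed.

Definition comp_closed S := forall p q, S p -> S q -> S (p \o q).

(** Ellis' lemma.  In a minimal closed subsemigroup [M] every [u] is
    idempotent: [M u] is a closed subsemigroup, hence all of [M], so some
    [p u = u]; the [p] with this property form in turn a closed subsemigroup,
    hence all of [M], and [u] is one of them. *)
Lemma ellis_idempotent S : compact S -> S !=set0 -> comp_closed S ->
  exists2 u, S u & u \o u = u.
Proof.
move=> cS S0 SS.
have clS : closed S by exact: compact_closed ptws_hausdorff cS.
have [|M [clM [u Mu] MS MM Mmin]] := minimal_closed cS clS S0 SS.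
  by move=> C _ CQ p q Cp Cq A CA; apply: (CQ _ CA); [exact: Cp|exact: Cq].
have cM : compact M by exact: subclosed_compact cS MS.
pose rmul p : {ptws X -> X} := p \o u.
have crmul : continuous rmul by exact: comp_continuousl.
have Mu_eq : rmul @` M = M.
  apply: Mmin.
  - apply: compact_closed ptws_hausdorff _; apply: continuous_compact cM.
    exact: continuous_subspaceT.
  - by exists (rmul u), u.
  - move=> _ _ [p Mp <-] [q Mq <-]; exists (p \o (u \o q)) => //.
    by apply: (MM) => //; exact: MM.
  - by move=> _ [p Mp <-]; exact: MM.
pose N := M `&` rmul @^-1` [set u].
have NM : N = M.
  apply: Mmin.
  - apply: closedI => //; apply: preimage_closed; last exact: ptws_set1_closed.
    by move=> p _; exact: crmul.
  - by move: Mu; rewrite -{1}Mu_eq => -[p Mp pu]; exists p.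
  - move=> p q [Mp pu] [Mq qu]; split; first exact: MM.
    by rewrite /= /rmul -compA -[q \o u]/(rmul q) qu.
  - exact: subIsetl.
exists u; first exact: MS.
by move: Mu; rewrite -{1}NM => -[].
Qed.

End PointwiseMaps.

(** * The enveloping semigroup *)

Section EnvelopingSemigroup.
Context {R : realType} {T : groupType} {X : metricType R}.
Variable phi : flow T X.
Implicit Types (p q u : {ptws X -> X}) (x y : X) (e : R).

Lemma enveloping_act t : enveloping phi (phi t).
Proof. by apply: subset_closure; exists t. Qed.

Lemma enveloping_id : enveloping phi id.
Proof.
have -> : id = phi 1%g by apply/funext => x; rewrite act1.
exact: enveloping_act.
Qed.

Lemma nbhs_eval p x e : 0 < e ->
  nbhs p [set q : {ptws X -> X} | mdist (p x) (q x) < e].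
Proof.
move=> e0; have := @eval_continuous X x p.
by move=> /cvgrPdist_lt/(_ e e0).
Qed.

Lemma enveloping_approx p x y e : enveloping phi p -> 0 < e ->
  exists t, mdist (p x) (phi t x) < e /\ mdist (p y) (phi t y) < e.
Proof.
move=> Ep e0.
have [_ [[t _ <-] [px py]]] :=
  Ep _ (filterI (nbhs_eval p x e0) (nbhs_eval p y e0)).
by exists t.
Qed.

(** Composition [p \o q] is continuous in [p], and in [q] when [p] is a
    continuous map: so the closure is taken over [q] with [p] in [T] first, and
    over [p] afterwards. *)
Lemma enveloping_comp p q : enveloping phi p -> enveloping phi q ->
  enveloping phi (p \o q).
Proof.
move=> Ep Eq.
have clE : closed (enveloping phi) by exact: closed_closure.
have preim (f : {ptws X -> X} -> {ptws X -> X}) : continuous f ->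
    (forall t, enveloping phi (f (phi t))) ->
    enveloping phi `<=` f @^-1` enveloping phi.
  move=> cf ft; have cl : closed (f @^-1` enveloping phi).
    by apply: preimage_closed clE => g _; exact: cf.
  apply: (subset_trans (closureS (B := f @^-1` enveloping phi) _)).
    by move=> _ [t _ <-]; exact: ft.
  by move/closure_id: cl => <-.
apply: (preim (fun p => p \o q)) Ep; first exact: comp_continuousl.
move=> t; apply: (preim (fun q => phi t \o q)) Eq => [|s].
  by apply: comp_continuousr; exact: act_continuous.
have -> : phi t \o phi s = phi (t * s)%g by apply/funext => x; rewrite /= actM.
exact: enveloping_act.
Qed.

Hypothesis cX : compact [set: X].

Let hX : hausdorff_space X := @metric_hausdorff R X.

Lemma enveloping_compact : compact (enveloping phi).
Proof.
have cXX : compact [set: {ptws X -> X}].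
  have := @tychonoff X (fun _ => X) (fun _ => [set: X]) (fun _ => cX).
  by congr (compact _); rewrite eqEsubset; split.
by apply: subclosed_compact cXX _ => //; exact: closed_closure.
Qed.

Definition comp_ideal p : set {ptws X -> X} :=
  (fun q => q \o p) @` enveloping phi.

Lemma comp_ideal_closed p : closed (comp_ideal p).
Proof.
apply: compact_closed; first exact: ptws_hausdorff.
apply: continuous_compact enveloping_compact.
by apply: continuous_subspaceT; exact: comp_continuousl.
Qed.

Lemma left_ideal_comp_ideal p :
  enveloping phi p -> left_ideal phi (comp_ideal p).
Proof.
move=> Ep; split; first by exists p, id => //; exact: enveloping_id.
  by move=> _ [q Eq <-]; exact: enveloping_comp.
move=> q _ Eq [r Er <-]; exists (q \o r) => //; exact: enveloping_comp.
Qed.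

(** Minimality must be tested against left ideals that need not be closed; any
    of them contains the closed left ideal generated by one of its elements. *)
Lemma minimal_ideal_sub (I : set {ptws X -> X}) :
  left_ideal phi I -> closed I -> exists2 M, minimal_ideal phi M & M `<=` I.
Proof.
move=> [I0 IE Iideal] clI.
have cI : compact I by exact: subclosed_compact enveloping_compact IE.
pose Q (J : set {ptws X -> X}) :=
  forall p q, enveloping phi p -> J q -> J (p \o q).
have [|M [clM M0 MI MQ Mmin]] := @minimal_closed _ I Q cI clI I0 Iideal.
  by move=> C _ CQ p q Ep Cq A CA; apply: (CQ _ CA) => //; exact: Cq.
exists M => //; split=> //.
  by split=> // p /MI/IE.
move=> J [[p Jp] JE Jideal] JM; have Ep := JE _ Jp.
have [Ep0 _ Epideal] := left_ideal_comp_ideal Ep.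
have EpJ : comp_ideal p `<=` J by move=> _ [q Eq <-]; exact: Jideal.
rewrite eqEsubset; split=> //.
rewrite -(Mmin (comp_ideal p))//; first exact: comp_ideal_closed.
exact: subset_trans JM.
Qed.

Lemma minimal_idempotent_in (I : set {ptws X -> X}) :
  left_ideal phi I -> closed I -> exists2 u, I u & minimal_idempotent phi u.
Proof.
move=> Iideal clI; have [M Mmin MI] := minimal_ideal_sub Iideal clI.
have [[M0 ME MM] clM _] := Mmin.
have cM : compact M by exact: subclosed_compact enveloping_compact ME.
have [|u Mu uu] := ellis_idempotent hX cM M0.
  by move=> p q /ME; exact: MM.
by exists u; [exact: MI|split=> //; exists M].
Qed.

Lemma minimal_idempotent_enveloping u :
  minimal_idempotent phi u -> enveloping phi u.
Proof. by move=> [_ [I [[_ + _] _ _]]]; apply. Qed.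

(** The direct implication takes a cluster point of the [t] that bring [x] and
    [y] close together, by compactness of the enveloping semigroup. *)
Lemma proximalP x y :
  proximal phi x y <-> exists2 p, enveloping phi p & p x = p y.
Proof.
split=> [[[a b] [/= clab ab]]|[p Ep pxy]]; last first.
  exists (p x, p y); split=> //= V [[/= V1 V2]].
  move=> [/nbhs_ballP[d d0 dV1] /nbhs_ballP[e e0 eV2]] VV.
  have de0 : 0 < Num.min d e by rewrite lt_min d0.
  have [t [px py]] := enveloping_approx x y Ep de0.
  exists (phi t x, phi t y); split; first by exists t.
  move: px py; rewrite !lt_min => /andP[px _] /andP[_ py].
  by apply: VV; split; [apply: dV1|apply: eV2]; rewrite ballEmdist.
have ba : b = a by [].
move: ba clab => -> {b ab} clab.
have near_diag e : 0 < e -> exists t, mdist (phi t x) (phi t y) < e.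
  move=> e0; have e20 : 0 < e / 2 by rewrite divr_gt0.
  have [|_ [[t _ <-]]] := clab (ball a (e / 2) `*` ball a (e / 2)).
    by exists (ball a (e / 2), ball a (e / 2)) => //; split; exact: nbhsx_ballx.
  rewrite !ballEmdist => -[/= ax ay]; exists t.
  rewrite (le_lt_trans (metric_triangle _ a _))// [e]splitr ltrD//.
  by rewrite metric_sym.
pose D e : set {ptws X -> X} :=
  [set q | enveloping phi q /\ mdist (q x) (q y) < e].
pose F := filter_from [set e : R | 0 < e] D.
have FF : ProperFilter F.
  apply: filter_from_proper; last first.
    move=> e e0; have [t te] := near_diag e e0.
    by exists (phi t); split=> //; exact: enveloping_act.
  apply: filter_from_filter; first by exists 1; exact: ltr01.
  move=> d e /= d0 e0; exists (Num.min d e); first by rewrite /= lt_min d0.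
  by move=> q [Eq]; rewrite lt_min => /andP[qd qe].
have [|p [Ep Fp]] := enveloping_compact FF.
  by exists 1; [exact: ltr01|move=> q []].
exists p => //; apply: mdist_lt_eq => e e0.
have e30 : 0 < e / 3 by rewrite divr_gt0.
have FD : F (D (e / 3)) by exists (e / 3).
have [q [[_ qxy] [px py]]] :=
  Fp _ _ FD (filterI (nbhs_eval p x e30) (nbhs_eval p y e30)).
have := metric_triangle (p x) (q x) (p y).
have := metric_triangle (q x) (q y) (p y).
move: px py qxy; rewrite /= (metric_sym (p y)); lra.
Qed.

Lemma proximal_idempotent x y : proximal phi x y ->
  exists2 u, minimal_idempotent phi u & u x = u y.
Proof.
move=> /proximalP[p Ep pxy].
have [_ [q Eq <-] umin] :=
  minimal_idempotent_in (left_ideal_comp_ideal Ep) (@comp_ideal_closed p).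
by exists (q \o p) => //=; rewrite pxy.
Qed.

Lemma distal_injective p : distal phi -> enveloping phi p -> injective p.
Proof. by move=> dphi Ep x y pxy; apply: dphi; apply/proximalP; exists p. Qed.

(** The closed left ideal generated by [p] contains an idempotent [q p], and an
    injective idempotent is the identity. *)
Lemma distal_left_inverse p : distal phi -> enveloping phi p ->
  exists2 q, enveloping phi q & cancel p q.
Proof.
move=> dphi Ep.
have [_ [q Eq <-] [qpqp _]] :=
  minimal_idempotent_in (left_ideal_comp_ideal Ep) (@comp_ideal_closed p).
exists q => // x; apply: (distal_injective dphi (enveloping_comp Eq Ep)).
by rewrite -[in RHS]qpqp.
Qed.

(** A uniform limit [u] of surjections has dense image, on which the idempotent
    [u] is the identity; as a uniform limit [u] is also continuous. *)
Lemma uniform_idempotent_id (u : X -> X) : u \o u = u ->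
  (forall e, 0 < e -> exists t, forall x, mdist (u x) (phi t x) < e) ->
  u = id.
Proof.
move=> uu ulim; apply/funext => x; apply/esym/mdist_lt_eq => e e0.
have e40 : 0 < e / 4 by rewrite divr_gt0.
have [s us] := ulim _ e40.
(* Continuity of [u] at [x], read off from that of the nearby map [phi s]. *)
have [r /= r0 rx] : exists2 r, 0 < r &
    forall y, mdist x y < r -> mdist (phi s x) (phi s y) < e / 4.
  have /cvgrPdist_lt/(_ _ e40)/nbhs_ballP[r /= r0 rx] :=
    @act_continuous _ _ _ phi s x.
  by exists r => // y xy; apply: rx; rewrite ballEmdist.
have [t ut] : exists t, forall y, mdist (u y) (phi t y) < Num.min r (e / 4).
  by apply: ulim; rewrite lt_min r0.
(* [u y] is a point of the image of [u] close to [phi t y = x]. *)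
pose y := phi t^-1%g x.
have := ut y; rewrite /y -actM mulgV act1 -/y lt_min => /andP[uyr uye].
have uuy : u (u y) = u y by rewrite -[in RHS]uu.
have suy : mdist (phi s x) (phi s (u y)) < e / 4.
  by apply: rx; rewrite metric_sym.
have := metric_triangle (u x) (phi s x) (u y).
have := metric_triangle (phi s x) (phi s (u y)) (u y).
have := metric_triangle (u x) (u y) x; have := us x; have := us (u y).
rewrite uuy (metric_sym (phi s (u y)) (u y)) (metric_sym x (u x)).
move: suy uye; lra.
Qed.

End EnvelopingSemigroup.

(** * Rigidity and equicontinuity on a compact flow *)

Section Equicontinuity.
Context {R : realType} {T : groupType} {X : metricType R}.
Variable phi : flow T X.
Implicit Types (x y : X) (d e : R).

(** A proximal pair is identified by a minimal idempotent, which strong rigidity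
    forces to be the identity. *)
Lemma strongly_rigid_distal :
  compact [set: X] -> strongly_rigid phi -> distal phi.
Proof.
move=> cX rphi x y /(proximal_idempotent cX)[u umin uxy].
suff uid : u = id by move: uxy; rewrite uid.
apply: (@uniform_idempotent_id _ _ _ phi); first by case: umin.
move=> e e0; have [K [le [t_ [[_ lexx _ _] _ ucvg]]]] := rphi u umin.
have [|k _ kt] := ucvg [set g : X -> X | forall x, mdist (u x) (g x) < e].
  by apply/nbhs_uniform_mdistP; exists e.
by exists (t_ k); exact: (kt k (lexx k)).
Qed.

Definition unif_equicontinuous := forall e, 0 < e -> exists2 d, 0 < d &
  forall t x y, mdist x y < d -> mdist (phi t x) (phi t y) < e.

Lemma compact_unif_equicontinuous : compact [set: X] ->
  flow_equicontinuous phi -> unif_equicontinuous.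
Proof.
move=> cX eqphi e e0; have e20 : 0 < e / 2 by rewrite divr_gt0.
have /compact_near_coveringP cov := cX.
have {}cov := cov R 0^'+ (fun d x => forall t y, mdist x y < d ->
    mdist (phi t x) (phi t y) < e)
  (@filter_filter _ _ (at_right_proper_filter 0)).
have [|d /= d0 H] := cov _; last first.
  exists (d / 2); first by rewrite divr_gt0.
  move=> t x y; apply: H => //=; last by rewrite divr_gt0.
  rewrite sub0r normrN gtr0_norm ?divr_gt0//.
  by rewrite ltr_pdivrMr// ltr_pMr// ltr1n.
move=> z _; have /nbhs_ballP[r /= r0 zr] := eqphi z _ e20.
have r20 : 0 < r / 2 by rewrite divr_gt0.
exists (ball z (r / 2), [set d | d < r / 2]) => /=.
  split; first exact: nbhsx_ballx.
  by exists (r / 2) => //= d /=; rewrite sub0r normrN => /ltr_normlW.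
move=> [x d] /= [+ dr] t y xy; rewrite ballEmdist /= => zx.
have fz w : mdist z w < r -> mdist (phi t w) (phi t z) < e / 2.
  by move=> zw; apply: zr; rewrite ballEmdist.
have /fz : mdist z x < r by lra.
have /fz : mdist z y < r by have := metric_triangle z x y; lra.
have := metric_triangle (phi t x) (phi t z) (phi t y).
rewrite (metric_sym (phi t z) (phi t y)); lra.
Qed.

(** If [phi t] sends [x] and [u x] near the common value [u x = u (u x)], then
    applying [phi t^-1] shows that [x] and [u x] are close. *)
Lemma unif_equicontinuous_idempotent (u : X -> X) : unif_equicontinuous ->
  minimal_idempotent phi u -> u = id.
Proof.
move=> eqphi umin; have [uu _] := umin.
have Eu := minimal_idempotent_enveloping umin.
apply/funext => x; apply/esym/mdist_lt_eq => e e0.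
have [d d0 dphi] := eqphi e e0; have d20 : 0 < d / 2 by rewrite divr_gt0.
have [t [ux uux]] := enveloping_approx x (u x) Eu d20.
have uxE : u (u x) = u x by rewrite -[in RHS]uu.
have := dphi t^-1%g (phi t x) (phi t (u x)); rewrite -!actM mulVg !act1; apply.
move: ux uux; rewrite uxE.
have := metric_triangle (phi t x) (u x) (phi t (u x)).
rewrite (metric_sym (phi t x) (u x)); lra.
Qed.

Lemma unif_equicontinuous_enveloping p e d :
  (forall t x y, mdist x y < d -> mdist (phi t x) (phi t y) < e) ->
  enveloping phi p -> forall x y, mdist x y < d -> mdist (p x) (p y) <= e.
Proof.
move=> dphi Ep x y xy; apply/ler_addgt0Pr => r r0.
have r20 : 0 < r / 2 by rewrite divr_gt0.
have [t [px py]] := enveloping_approx x y Ep r20; have := dphi t x y xy.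
have := metric_triangle (p x) (phi t x) (p y).
have := metric_triangle (phi t x) (phi t y) (p y).
rewrite (metric_sym (phi t y) (p y)); move: px py; lra.
Qed.

(** [T] being infinite, its elements have a cluster point [p] along the
    cofinite filter, and a filter [G] of elements of [T] converges to [p]
    pointwise, hence uniformly by equicontinuity and compactness.  Two distinct
    elements uniformly close to [p] then have a quotient uniformly close to the
    identity. *)
Lemma unif_equicontinuous_recurrent :
  infinite_set [set: T] -> compact [set: X] ->
  unif_equicontinuous -> forall e, 0 < e ->
  exists2 t, t <> 1%g & forall x, mdist x (phi t x) < e.
Proof.
move=> infT cX eqphi e e0; have e80 : 0 < e / 8 by rewrite divr_gt0.
pose cofin : set_system T := [set A | finite_set (~` A)].
have cofinF : ProperFilter cofin.
  split; first by rewrite /cofin /= setC0.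
  split; first by rewrite /cofin /= setCT.
  - by move=> A B Afin Bfin; rewrite /cofin /= setCI finite_setU.
  - by move=> A B AB; apply: sub_finite_set; exact: subsetC.
pose F : set_system {ptws X -> X} := (phi : T -> {ptws X -> X}) @ cofin.
have [|p [Ep clFp]] := @enveloping_compact _ _ _ phi cX F _.
  by apply: (@filterS T cofin _ setT) filterT => t _; exact: enveloping_act.
have : cluster F p by [].
rewrite cluster_cvgE => -[G GF [Gp FG]].
have [d d0 dphi] := eqphi _ e80.
have Gnear : G [set g | forall x, mdist (p x) (g x) < e / 2].
  have /compact_near_coveringP cov := cX.
  have {}cov := cov _ G (fun g x => mdist (p x) (g x) < e / 2)
    (@filter_filter _ _ GF).
  apply: (@filterS _ G _ _ _ _ (cov _)) => [g pg x|]; first exact: pg.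
  move=> x _; exists (ball x d,
    [set g | (range phi) g /\ mdist (p x) (g x) < e / 8]) => /=.
    split; first exact: nbhsx_ballx.
    apply: filterI; last by apply: Gp; exact: nbhs_eval.
    by apply: FG; apply: (@filterS T cofin _ setT) filterT => t _; exists t.
  move=> [y g] /= [+ [[t _ <-] ptx]]; rewrite ballEmdist /= => xy.
  have := dphi t x y xy; have := unif_equicontinuous_enveloping dphi Ep xy.
  have := metric_triangle (p y) (p x) (phi t y).
  have := metric_triangle (p x) (phi t x) (phi t y).
  rewrite (metric_sym (p y) (p x)); lra.
have close A : cofin A ->
    exists2 t, A t & forall x, mdist (p x) (phi t x) < e / 2.
  move=> Acofin; have GA : G (phi @` A).
    by apply: FG; apply: (@filterS T cofin _ A) Acofin => t At; exists t.
  by have [_ [[t At <-] pt]] := filter_ex (filterI GA Gnear); exists t.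
have [t _ pt] := close setT filterT.
have [|s st ps] := close (~` [set t]); first by rewrite /cofin /= setCK.
exists (t * s^-1)%g.
  by move=> ts1; apply: st; rewrite /= -[t]mulg1 -(mulVg s) mulgA ts1 mul1g.
move=> x; rewrite actM; set y := phi _ x.
have -> : x = phi s y by rewrite -actM mulgV act1.
have := pt y; have := ps y; have := metric_triangle (phi s y) (p y) (phi t y).
rewrite (metric_sym (phi s y) (p y)); lra.
Qed.

End Equicontinuity.

(** * The induced flow on the hyperspace *)

Section InducedFlow.
Context {R : realType} {T : groupType} {X : metricType R}.
Variables (cX : compact [set: X]) (phi : flow T X).
Implicit Types (A B : hyperspace cX) (x y : X).

Local Notation H := (hyperflow cX phi).
Local Notation selfmap := {ptws (hyperspace cX) -> (hyperspace cX)}.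

Let cH : compact [set: hyperspace cX] := hyperspace_compact.

Lemma hyper_act_set1 t x : H t (hyper1 cX x) = hyper1 cX (phi t x).
Proof. by apply: hyperspace_eq => /=; rewrite image_set1. Qed.

Lemma mdist_hyper1 x y : mdist (hyper1 cX x) (hyper1 cX y) = mdist x y.
Proof.
apply/eqP; rewrite eq_le; apply/andP; split.
  apply: mdist_hyperspace_le => _ ->; first by exists y.
  by exists x => //; rewrite metric_sym.
apply/ler_addgt0Pr => e e0.
set D := mdist (hyper1 cX x) _.
have xy : D < D + e by rewrite ltrDl.
by have [_ -> /ltW] := mdist_hyperspace_lt xy (erefl : hset (hyper1 cX x) x).
Qed.

Lemma hyperflow_unif_equicontinuous :
  unif_equicontinuous phi -> unif_equicontinuous H.
Proof.
move=> eqphi e e0; have e20 : 0 < e / 2 by rewrite divr_gt0.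
have [d d0 dphi] := eqphi _ e20; exists d => // t A B AB.
have half C D : mdist C D < d -> forall c, hset (H t C) c ->
    exists2 b, hset (H t D) b & mdist c b <= e / 2.
  move=> CD _ [c Cc <-]; have [b Db cb] := mdist_hyperspace_lt CD Cc.
  by exists (phi t b); [exists b|apply/ltW/dphi].
apply: (@le_lt_trans _ _ (e / 2)); last by lra.
by apply: mdist_hyperspace_le; apply: half => //; rewrite metric_sym.
Qed.

Lemma hyperflow_equicontinuousP :
  flow_equicontinuous H <-> unif_equicontinuous phi.
Proof.
split=> [eqH|/hyperflow_unif_equicontinuous eqphi A e e0]; last first.
  have [d d0 dphi] := eqphi e e0.
  apply/nbhs_ballP; exists d => //= B; rewrite ballEmdist => AB t.
  by apply: dphi; rewrite metric_sym.
apply: compact_unif_equicontinuous => // y e e0.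
have /nbhs_ballP[d /= d0 dH] := eqH (hyper1 cX y) e e0.
apply/nbhs_ballP; exists d => //= x; rewrite ballEmdist => yx t.
have xy : ball (hyper1 cX y) d (hyper1 cX x).
  by rewrite ballEmdist /= mdist_hyper1.
rewrite -(mdist_hyper1 (phi t x)) -!hyper_act_set1; exact: dH xy t.
Qed.

Lemma hyper_equicontinuous_strongly_rigid : infinite_set [set: T] ->
  flow_equicontinuous H -> strongly_rigid H.
Proof.
move=> infT /hyperflow_equicontinuousP/hyperflow_unif_equicontinuous eqH u umin.
have uid := unif_equicontinuous_idempotent eqH umin.
have recur (n : nat) : {t | t <> 1%g &
    forall A, mdist A (H t A) < n.+1%:R^-1}.
  by apply: cid2; apply: unif_equicontinuous_recurrent; rewrite ?invr_gt0.
pose t_ n := s2val (recur n).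
exists nat, (fun m n => (m <= n)%N), t_; split.
- split; [by exists 0%N|exact: leqnn|move=> k l m; exact: leq_trans|].
  by move=> k l; exists (maxn k l); [exact: leq_maxl|exact: leq_maxr].
- by move=> n; split=> [_|]; [exact: (s2valP (recur n))|rewrite uid].
- rewrite uid => P /nbhs_uniform_mdistP[e e0 eP].
  have [N Ne] : exists N : nat, N.+1%:R^-1 < e.
    by have [N] := ltr_add_invr e0; rewrite add0r; exists N.
  exists N => // n /= Nn; apply: eP => A /=.
  apply: lt_trans (s2valP' (recur n) A) _; apply: le_lt_trans Ne.
  by rewrite lef_pV2 ?posrE// ler_nat.
Qed.

(** Inclusion is preserved by every [t] and is a closed condition. *)
Lemma enveloping_hyperflow_mono (p : selfmap) A B :
  enveloping H p -> hset A `<=` hset B ->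
  hset (p A) `<=` hset (p B).
Proof.
move=> Ep AB x pAx; apply: mem_hyperspace => e e0.
have e20 : 0 < e / 2 by rewrite divr_gt0.
have [t [pA pB]] := enveloping_approx A B Ep e20.
have [_ [a Aa <-] xa] := mdist_hyperspace_lt pA pAx.
have taB : hset (H t B) (phi t a) by exists a => //; exact: AB.
rewrite metric_sym in pB; have [b pBb ab] := mdist_hyperspace_lt pB taB.
by exists b => //; have := metric_triangle x (phi t a) b; lra.
Qed.

(** The cluster point [(p, z)] remembers both the limit of the action on closed
    sets and the limit of the points [phi t x] that stay away from [phi t y];
    pulling [z] back by the inverse of [p] would send it to [y]. *)
Lemma hyper_distal_equicontinuous :
  distal H -> flow_equicontinuous phi.
Proof.
move=> dH y e e0; apply: contrapT => neq.
pose A_ (d : R) (d0 : 0 < d) := cball cX y (ltW d0).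
have far (d : R) : 0 < d ->
    exists t x, mdist y x <= d /\ e <= mdist (phi t x) (phi t y).
  move=> d0; apply: contrapT => nfar; apply: neq.
  apply/nbhs_ballP; exists d => //= x.
  rewrite ballEmdist /= => yx t; rewrite ltNge; apply/negP => ex.
  by apply: nfar; exists t, x; split=> //; exact: ltW.
pose D d : set (selfmap * X) :=
  [set gz | exists t x,
  [/\ gz = (H t, phi t x), mdist y x <= d & e <= mdist (phi t x) (phi t y)]].
pose F := filter_from [set d : R | 0 < d] D.
have FF : ProperFilter F.
  apply: filter_from_proper; last first.
    by move=> d /far[t [x [yx ex]]]; exists (H t, phi t x), t, x.
  apply: filter_from_filter; first by exists 1; exact: ltr01.
  move=> c d /= c0 d0; exists (Num.min c d); first by rewrite /= lt_min c0.
  move=> _ [t [x [-> + ex]]]; rewrite le_min => /andP[yc yd].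
  by split; exists t, x.
have [|[p z] [[/= Ep _] Fpz]] :=
    compact_setX (enveloping_compact (phi := H) cH) cX FF.
  exists 1; first exact: ltr01.
  by move=> _ [t [x [-> _ _]]]; split => //; exact: enveloping_act.
(* The sets [A_ d d0] and [{y}] are fixed before [t] and [x] are chosen,
   since a neighbourhood of [p] controls finitely many closed sets only. *)
have limit (d r : R) (d0 : 0 < d) : 0 < r -> exists t x,
    [/\ mdist y x <= d, e <= mdist (phi t x) (phi t y), mdist z (phi t x) < r,
      mdist (p (A_ d d0)) (H t (A_ d d0)) < r &
      mdist (p (hyper1 cX y)) (H t (hyper1 cX y)) < r].
  move=> r0.
  pose V := [set g : selfmap | mdist (p (A_ d d0)) (g (A_ d d0)) < r] `&`
    [set g | mdist (p (hyper1 cX y)) (g (hyper1 cX y)) < r].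
  have FD : F (D d) by exists d.
  have [|_ [[t [x [-> yx ex]]] [[/= pA py] zx]]] := Fpz _ (V `*` ball z r) FD.
    exists (V, ball z r) => //; split; last exact: nbhsx_ballx.
    by apply: filterI; exact: nbhs_eval.
  by exists t, x; split=> //; move: zx; rewrite ballEmdist.
have pz (d : R) (d0 : 0 < d) : hset (p (A_ d d0)) z.
  apply: mem_hyperspace => r r0; have r20 : 0 < r / 2 by rewrite divr_gt0.
  have [t [x [yx _ zx pA _]]] := limit d _ d0 r20.
  have tx : hset (H t (A_ d d0)) (phi t x) by exists x.
  rewrite metric_sym in pA; have [w pw xw] := mdist_hyperspace_lt pA tx.
  by exists w => //; have := metric_triangle z (phi t x) w; lra.
have npz : ~ hset (p (hyper1 cX y)) z.
  move=> py; have e20 : 0 < e / 2 by rewrite divr_gt0.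
  have [t [x [_ ex zx _ pyt]]] := limit 1 _ ltr01 e20.
  have [_ [_ -> <-] zy] := mdist_hyperspace_lt pyt py.
  move: ex; apply/negP; rewrite -ltNge.
  have := metric_triangle (phi t x) z (phi t y).
  by rewrite (metric_sym _ z); lra.
have [q Eq pK] := distal_left_inverse cH dH Ep.
have qz : q (hyper1 cX z) = q (p (hyper1 cX y)).
  rewrite pK; apply: hyperspace_eq.
  have qzy w : hset (q (hyper1 cX z)) w -> y = w.
    move=> qzw; apply: mdist_lt_eq => r r0.
    have r20 : 0 < r / 2 by rewrite divr_gt0.
    have zA : hset (hyper1 cX z) `<=` hset (p (A_ _ r20))
      by move=> x /= ->; exact: pz.
    have := enveloping_hyperflow_mono Eq zA qzw; rewrite pK /=; lra.
  have [w qzw] := hset_nonempty (q (hyper1 cX z)).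
  by rewrite eqEsubset; split=> [x /qzy <-|x /= ->] //; rewrite (qzy _ qzw).
apply: npz; by rewrite -(distal_injective cH dH Eq qz).
Qed.

End InducedFlow.

Theorem theorem2p22 (R : realType) (T : groupType) (X : metricType R)
    (infT : infinite_set [set: T]) (cX : compact [set: X])
    (infX : infinite_set [set: X]) (phi : flow T X) :
  [<-> flow_equicontinuous phi;
       flow_equicontinuous (hyperflow cX phi);
       strongly_rigid (hyperflow cX phi);
       distal (hyperflow cX phi)].
Proof.
tfae.
- move=> eqphi; apply/hyperflow_equicontinuousP.
  exact: compact_unif_equicontinuous.
- exact: hyper_equicontinuous_strongly_rigid.
- by apply: strongly_rigid_distal; exact: hyperspace_compact.
- exact: hyper_distal_equicontinuous.
Qed.
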